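(* For every positive integer $m$ there exists a number $\nu(m)$, depending only on $m$, such that the following holds: if $w$ is a weakly rational group-word and $G$ is a residually finite group in which $w$ has at most $m$ values (that is, $|G_w|\le m$), then the verbal subgroup $w(G)$ is finite and $|w(G)|\le \nu(m)$.
   Context: A group-word $w=w(x_1,\dots,x_k)$ is an element of the free group on $x_1,\dots,x_k$. For a group $G$, $G_w$ denotes the set of all values $w(g_1,\dots,g_k)$ with $g_1,\dots,g_k\in G$, and the verbal subgroup $w(G)$ is the subgroup of $G$ generated by $G_w$. The word $w$ is called weakly rational if for every finite group $H$, every $g\in H$, and every integer $e$ relatively prime to $|H|$, one has $g\in H_w$ if and only if $g^e\in H_w$. *)

(* Defs.v *)
(* MathComp, with classical_sets / cardinality for subsets of infinite groups. *)
From mathcomp Require Import all_boot fingroup ssrint intdiv.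
From mathcomp Require Import boolp classical_sets functions cardinality.

Set Implicit Arguments.
Unset Strict Implicit.
Unset Printing Implicit Defensive.

Local Open Scope group_scope.
Local Open Scope classical_set_scope.

(* The letter (i, false) stands for x_i and (i, true) for its inverse. *)
Definition letter (k : nat) : Type := ('I_k * bool)%type.

Definition reduced (k : nat) (s : seq (letter k)) : bool :=
  sorted (fun a b : letter k => ~~ ((a.1 == b.1) && (a.2 != b.2))) s.

(* The free group on x_0, ..., x_(k-1), each element being represented by its
   unique reduced word. *)
Definition group_word (k : nat) : Type := {s : seq (letter k) | reduced s}.

Definition word_eval (k : nat) (w : group_word k) (G : groupType)
    (g : 'I_k -> G) : G :=
  \prod_(a <- val w) (if a.2 then (g a.1)^-1 else g a.1).

Definition word_values (k : nat) (w : group_word k) (G : groupType) : set G :=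
  range (fun g : 'I_k -> G => word_eval w g).
Arguments word_values {k} w G _.

(* The intersection of all subgroups of G that contain the w-values. *)
Definition verbal_subgroup (k : nat) (w : group_word k) (G : groupType) :
    set G :=
  smallest [set A : set G | group_closed (mem A)] (word_values w G).
Arguments verbal_subgroup {k} w G _.

Definition zexpg (G : groupType) (g : G) (e : int) : G :=
  match e with
  | Posz n => g ^+ n
  | Negz n => g ^- n.+1
  end.

Definition weakly_rational (k : nat) (w : group_word k) : Prop :=
  forall (H : finGroupType) (g : H) (e : int),
    coprimez e #|H| -> (word_values w H g <-> word_values w H (zexpg g e)).

(* Magma morphisms between groups preserve 1 and inverses. *)
Definition residually_finite (G : groupType) : Prop :=
  forall g : G, g <> 1 ->
    exists (H : finGroupType) (f : {multiplicative G -> H}), f g <> 1.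

(* Main.v *)
Require Import Defs.
From mathcomp Require Import all_boot fingroup ssrint intdiv.
From mathcomp Require Import boolp classical_sets functions cardinality.
From mathcomp Require Import cyclic.

(** The set [X] of [w]-values has at most [m] elements and is stable under
    conjugation. Dietzmann's lemma says that such a set generates a finite
    subgroup as soon as its elements have finite order, and its proof gives a
    bound: if [x ^+ E = 1] for every [x] in [X], then every element of [w(G)]
    is a product of exactly [size X * E] elements of [X], so that
    [w(G)] has at most [size X ^ (size X * E)] elements
    ([generated_sub_word_products]).

    The exponent [E] has to depend on [m] only, and this is where the two
    hypotheses on [w] and [G] enter. In a finite group [H] with at most [m]
    values, take a value [g] of order [n]. Every generator of the cyclic group
    of [g] can be written [g ^+ e] with [e] prime to the order of [H], not
    merely to [n] ([coprime_lift]), so weak rationality makes all these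
    generators values of [w]: Euler's function satisfies [totient n <= m]
    ([totient_order_value]). Each prime power in the factorization of [n] is
    then at most [2 m], hence [n] divides [(2 m)!] ([dvdn_fact_totient]).
    Finite images of [G] have no more values than [G], so the identity
    [x ^+ (2 m)! = 1] holds for the image of every value [x] in every finite
    quotient, and residual finiteness transports it to [G]
    ([expg_value_eq1]). *)

Set Implicit Arguments.
Unset Strict Implicit.
Unset Printing Implicit Defensive.

Local Open Scope classical_set_scope.
Local Open Scope card_scope.

(** * Orders with small totient *)

(** A prime power [p ^ e] with [0 < e] is at most twice its totient
    [p.-1 * p ^ e.-1], because [p <= 2 * p.-1]; and the totient of each
    primary part of [n] is at most that of [n]. *)
Lemma dvdn_fact_totient (m n : nat) :
  (0 < n)%N -> (totient n <= m)%N -> (n %| (2 * m)`!)%N.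
Proof.
move=> n_gt0 le_m; apply/dvdn_partP => // p p_n.
have p_pr : prime p by move: p_n; rewrite mem_primes => /andP[].
have p_dvd : (p %| n)%N by move: p_n; rewrite mem_primes => /and3P[].
have le_part : (totient n`_p <= m)%N.
  apply: leq_trans le_m; rewrite -{2}(partnC p n_gt0) totient_coprime.
    by rewrite leq_pmulr // totient_gt0 part_gt0.
  exact: coprime_partC.
have e_gt0 : (0 < logn p n)%N by rewrite logn_gt0.
move: le_part; rewrite p_part totient_pfactor // => le_part.
apply: dvdn_fact; rewrite expn_gt0 prime_gt0 //=.
apply: leq_trans (leq_mul (leqnn 2) le_part).
rewrite -{1}(prednK e_gt0) expnS mulnA leq_mul2r.
apply/orP; right; have := prime_gt1 p_pr.
by case: (p) => [|[|q]] // _; rewrite mul2n -addnn addSn ltnS leq_addl.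
Qed.

(** Surjectivity of the reduction from the units modulo [N] to the units
    modulo [n], for [n] dividing [N]. The representative is [e + n * t] with
    [t] the part of [N] prime to [e]: a prime divisor of [N] divides exactly one
    of [e] and [n * t]. *)
Lemma coprime_lift (n N e : nat) :
    (0 < n)%N -> (0 < N)%N -> coprime n e ->
  exists2 e' : nat, coprime e' N & (e' = e %[mod n])%N.
Proof.
move=> n_gt0 N_gt0 co_ne; pose t := N`_[pred p | ~~ (p %| e)%N].
have prime_t p : (p \in primes t) = ~~ (p %| e)%N && (p \in primes N).
  by rewrite primes_part mem_filter.
exists (e + n * t)%N; last by rewrite addnC mulnC modnMDl.
have s_gt0 : (0 < e + n * t)%N by rewrite addn_gt0 muln_gt0 n_gt0 part_gt0 orbT.
rewrite coprime_has_primes //; apply/hasPn => p pN; rewrite /= mem_primes s_gt0.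
have p_pr : prime p by move: pN; rewrite mem_primes => /andP[].
rewrite p_pr /=; case p_e: (p %| e)%N; last first.
  have: p \in primes t by rewrite prime_t p_e.
  by rewrite mem_primes => /and3P[_ _ p_t]; rewrite dvdn_addl ?dvdn_mull // p_e.
rewrite dvdn_addr // Euclid_dvdM // negb_or; apply/andP; split.
  by apply: contraL co_ne => p_n; apply/negP => /(coprime_dvdl p_n);
     rewrite prime_coprime // p_e.
apply/negP => p_t; have: p \in primes t by rewrite mem_primes p_pr part_gt0.
by rewrite prime_t p_e.
Qed.

(** * Group words and morphisms *)

(** A bare function with a morphism property, rather than a bundled morphism,
    lets the same lemmas apply to conjugations and to the corestriction of a
    map to its image. *)
Section Morphisms.

Variables (G H : groupType) (f : G -> H).
Hypothesis fM : {morph f : x y / (x * y)%g}.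

Lemma morph_one : f 1%g = 1%g.
Proof. by apply: (mulgI (f 1%g)); rewrite -fM !mulg1. Qed.

Lemma morph_inv x : f x^-1%g = (f x)^-1%g.
Proof. by apply: (mulgI (f x)); rewrite -fM !mulgV morph_one. Qed.

Lemma morph_exp n x : f (x ^+ n)%g = (f x ^+ n)%g.
Proof. by elim: n => [|n IHn]; rewrite ?expg0 ?morph_one // !expgS fM IHn. Qed.

Lemma word_eval_morph k (w : group_word k) (g : 'I_k -> G) :
  f (word_eval w g) = word_eval w (f \o g).
Proof.
rewrite /word_eval (big_morph f fM morph_one).
by apply: eq_bigr => a _; case: ifP => _ //=; rewrite morph_inv.
Qed.

Lemma word_values_morph k (w : group_word k) x :
  word_values w G x -> word_values w H (f x).
Proof. by case=> g _ <-; exists (f \o g); rewrite ?word_eval_morph. Qed.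

Lemma word_values_surj k (w : group_word k) y :
    (forall z, exists x, f x = z) ->
  word_values w H y -> exists2 x, word_values w G x & f x = y.
Proof.
move=> f_surj [h _ <-]; have [g fg] := choice (fun i => f_surj (h i)).
exists (word_eval w g); first by exists g.
by rewrite word_eval_morph; congr word_eval; apply/funext => i /=; rewrite fg.
Qed.

End Morphisms.

(** Conjugation is an endomorphism, and endomorphisms preserve word values. *)
Lemma word_valuesJ (G : groupType) k (w : group_word k) (x y : G) :
  word_values w G x -> word_values w G (x ^ y)%g.
Proof.
apply: (@word_values_morph G G (fun x => x ^ y)%g) => a b.
exact: conjMg.
Qed.

Lemma word_values1 (G : groupType) k (w : group_word k) : word_values w G 1%g.
Proof.
exists (fun=> 1%g) => //; rewrite /word_eval big1 // => a _.
by case: ifP => _; rewrite ?invg1.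
Qed.

(** * Values of weakly rational words have bounded order *)

(** There are [totient #[g]] generators of the cyclic group of [g]. Weak
    rationality only speaks of exponents prime to the order of [H], whence the
    lift of the exponent before it is applied. *)
Lemma totient_order_value (H : finGroupType) k (w : group_word k) (X : seq H)
    (g : H) :
    weakly_rational w -> (forall h, word_values w H h -> h \in X) ->
  word_values w H g -> (totient #[g]%g <= size X)%N.
Proof.
move=> wr HX gw; rewrite totient_gen.
apply: leq_trans (card_size X); apply: subset_leq_card.
apply/fintype.subsetP => x; rewrite inE => gen_x.
have /cycleP[e x_e] : x \in <[g]>%g.
  by have /eqP -> := gen_x; apply: cycle_id.
move: gen_x; rewrite x_e generator_coprime => co_e.
have H_gt0 : (0 < #|H|)%N by rewrite -cardsT cardG_gt0.
have [e' co_e' /eqP] := coprime_lift (order_gt0 g) H_gt0 co_e.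
rewrite -eq_expg_mod_order => /eqP <-; apply: HX.
exact/(wr H g (Posz e')).
Qed.

(** If this power of [x] were not [1], some morphism to a finite group would
    separate it from [1]; but the image of [x] is a value of [w] in a finite
    group with at most [size X] values. *)
Lemma expg_value_eq1 (G : groupType) k (w : group_word k) (X : seq G) (x : G) :
    weakly_rational w -> residually_finite G ->
    (forall h, word_values w G h -> h \in X) ->
  word_values w G x -> (x ^+ (2 * size X)`!)%g = 1%g.
Proof.
move=> wr rf GX xw; apply: contrapT => /rf[K [f]]; apply.
have fM : {morph f : x y / (x * y)%g} by exact: gmulfM.
(* The target K of f may have more w-values than G; its subgroup f(G) does
   not, so the bound on orders is applied to f(G) as a group of its own. *)
pose S := finset (fun y : K => `[< exists u, f u = y >]).
have inS y : reflect (exists u, f u = y) (y \in S).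
  by rewrite finset.in_set; apply: asboolP.
have S_group : group_set S.
  apply/group_setP; split=> [|a b].
    by apply/inS; exists 1%g; apply: (morph_one fM).
  by move=> /inS[u <-] /inS[v <-]; apply/inS; exists (u * v)%g; apply: fM.
pose A := Group S_group.
have fA y : f y \in A by apply/inS; exists y.
pose F y := subg A (f y).
have FM : {morph F : x y / (x * y)%g}.
  by move=> a b; apply: val_inj; rewrite /= !subgK // fM.
have F_surj z : exists y, F y = z.
  have /inS[y fy] := subgP z; exists y.
  by apply: val_inj; rewrite /= subgK.
have HX h : word_values w [subg A] h -> h \in map F X.
  by move=> /(word_values_surj FM F_surj)[y /GX yX <-]; apply: map_f.
have := totient_order_value wr HX (word_values_morph FM xw).
rewrite size_map => /(dvdn_fact_totient (order_gt0 _)).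
rewrite order_dvdn -(morph_exp FM) => /eqP /(congr1 sgval).
by rewrite subgK.
Qed.

(** * Dietzmann's lemma *)

(** Double counting of the pairs formed by an entry of [s] and an equal entry of
    [X]; no entry of [s] is missed, since they all lie in [X]. *)
Lemma pigeonhole_count (T : eqType) (X s : seq T) (E : nat) :
    {subset s <= X} -> (size X * E < size s)%N ->
  exists2 x, x \in X & (E < count_mem x s)%N.
Proof.
move=> sX; apply: contraPP => noX; apply/negP; rewrite -leqNgt.
have -> : size s = (\sum_(y <- s) 1)%N by rewrite sum1_size.
apply: (@leq_trans (\sum_(y <- s) \sum_(x <- X) (y == x))).
  rewrite big_seq [leqRHS]big_seq; apply: leq_sum => y /sX yX.
  by rewrite (big_rem y) //= eqxx.
rewrite exchange_big /= -sum1_size big_distrl /= big_seq [leqRHS]big_seq.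
apply: leq_sum => x xX; rewrite mul1n leqNgt; apply/negP => lt_E.
by apply: noX; exists x; rewrite // -sum1_count big_mkcond.
Qed.

Section Dietzmann.

Variables (G : groupType) (X : seq G) (E : nat).
Hypothesis XJ : {in X &, forall x y, (x ^ y)%g \in X}.
Hypothesis XE : {in X, forall x, (x ^+ E)%g = 1%g}.
Hypothesis E_gt0 : (0 < E)%N.
Hypothesis X1 : 1%g \in X.

(** Occurrences of [x] move to the front by the identity
    [a * x ^+ j = x ^+ j * a ^ (x ^+ j)]: each letter they jump over is replaced
    by a conjugate, which is again a letter, so the total length is unchanged. *)
Lemma collect_power x j s : x \in X -> {subset s <= X} ->
    (j <= count_mem x s)%N ->
  exists t, [/\ {subset t <= X}, (size t + j = size s)%N &
    (\prod_(y <- s) y = x ^+ j * \prod_(y <- t) y)%g].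
Proof.
move=> xX; elim: s j => [|a s IHs] j sX /=.
  by rewrite leqn0 => /eqP->; exists [::]; rewrite expg0 mul1g.
have aX : a \in X by apply: sX; rewrite mem_head.
have {}sX : {subset s <= X} by move=> y ys; apply: sX; rewrite inE ys orbT.
have [-> | a_x] := eqVneq a x; last first.
  move=> /(IHs _ sX)[t [tX szt eq_t]].
  have ajX : (a ^ (x ^+ j))%g \in X.
    by elim: (j) => [|i IHi]; rewrite ?conjg1 // expgSr conjgM XJ.
  exists ((a ^ (x ^+ j))%g :: t); split.
  - by move=> y; rewrite inE => /predU1P[->|/tX].
  - by rewrite /= addSn szt.
  - by rewrite !big_cons eq_t mulgA (conjgC a) -mulgA.
case: j => [_|j]; first exists (x :: s).
  by rewrite expg0 mul1g addn0; split=> // y; rewrite inE => /predU1P[->|/sX].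
rewrite add1n ltnS => /(IHs _ sX)[t [tX szt eq_t]].
by exists t; rewrite addnS szt big_cons eq_t expgS mulgA.
Qed.

(** A word of length more than [size X * E] contains some letter [x] at least [E]
    times; once collected at the front, these occurrences cancel because
    [x ^+ E = 1]. *)
Lemma prod_shorten s : {subset s <= X} ->
  exists t, [/\ {subset t <= X}, (size t <= size X * E)%N &
    (\prod_(y <- s) y = \prod_(y <- t) y)%g].
Proof.
have [n] := ubnP (size s); elim: n s => // n IHn s; rewrite ltnS => le_n sX.
have [le_s|lt_s] := leqP (size s) (size X * E); first by exists s.
have [x xX /ltnW lt_E] := pigeonhole_count sX lt_s.
have [t [tX szt ->]] := collect_power xX sX lt_E.
rewrite XE // mul1g; apply: IHn => //.
by apply: leq_trans le_n; rewrite -szt -addn1 leq_add2l.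
Qed.

(** Words of a single common length are easier to enumerate than words of
    bounded length; [1] serves as a neutral letter. *)
Lemma prod_pad n s : {subset s <= X} -> (size s <= n)%N ->
  exists t, [/\ {subset t <= X}, size t = n &
    (\prod_(y <- s) y = \prod_(y <- t) y)%g].
Proof.
move=> sX le_n; exists (s ++ nseq (n - size s) 1%g); split.
- by move=> y; rewrite mem_cat mem_nseq => /orP[/sX|/andP[_ /eqP->]].
- by rewrite size_cat size_nseq subnKC.
- by rewrite big_cat /= [X in (_ * X)%g]big_nseq iter_fix ?mulg1.
Qed.

(** Since [X] is not assumed stable under inversion, the inverse of a letter [a]
    is written as the positive power [a ^+ E.-1]. *)
Lemma prod_inv s : {subset s <= X} ->
  exists2 t, {subset t <= X} & ((\prod_(y <- s) y)^-1 = \prod_(y <- t) y)%g.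
Proof.
elim: s => [|a s IHs] sX; first by exists [::]; rewrite // big_nil invg1.
have aX : a \in X by apply: sX; rewrite mem_head.
have [|t tX eq_t] := IHs; first by move=> y ys; apply: sX; rewrite inE ys orbT.
exists (t ++ nseq E.-1 a).
  by move=> y; rewrite mem_cat mem_nseq => /orP[/tX|/andP[_ /eqP->]].
rewrite big_cons invgM eq_t big_cat /=; congr (_ * _)%g.
by apply: (mulIg a); rewrite mulVg big_nseq iter_mulg_1 -expgSr prednK // XE.
Qed.

Fixpoint word_products (n : nat) : seq G :=
  if n is n'.+1 then [seq (x * y)%g | x <- X, y <- word_products n'] else [:: 1%g].

Lemma size_word_products n : size (word_products n) = (size X ^ n)%N.
Proof. by elim: n => //= n IHn; rewrite size_allpairs IHn expnS. Qed.

Lemma prod_in_word_products s : {subset s <= X} ->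
  (\prod_(y <- s) y)%g \in word_products (size s).
Proof.
elim: s => [|a s IHs] sX /=; first by rewrite big_nil inE.
rewrite big_cons; apply: allpairs_f; first by apply: sX; rewrite mem_head.
by apply: IHs => y ys; apply: sX; rewrite inE ys orbT.
Qed.

(** Products of words over [X] form a subgroup containing [X], and each such word
    can be shortened and then padded to length [size X * E]. *)
Lemma generated_sub_word_products :
  smallest [set A : set G | group_closed (mem A)] [set` X]
    `<=` [set` word_products (size X * E)].
Proof.
apply: (@subset_trans _
  [set g | exists2 s, {subset s <= X} & g = (\prod_(y <- s) y)%g]); last first.
  move=> _ [s sX ->]; have [t [tX szt ->]] := prod_shorten sX.
  have [u [uX <- ->]] := prod_pad tX szt.
  exact: prod_in_word_products.
apply: smallest_sub => [|x /= xX]; last first.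
  by exists [:: x]; rewrite ?big_seq1 // => y; rewrite inE => /eqP->.
split; first by rewrite inE; exists [::]; rewrite // big_nil.
move=> a b; rewrite !inE => -[s sX ->] [t /prod_inv[u uX eq_u] ->].
rewrite eq_u; exists (s ++ u); last by rewrite big_cat.
by move=> y; rewrite mem_cat => /orP[/sX|/uX].
Qed.

End Dietzmann.

(** * Counting *)

Lemma sub_seq_card_le (T : eqType) (A : set T) (s : seq T) :
  A `<=` [set` s] -> A #<= `I_(size s).
Proof.
move=> As; apply/pcard_leP/injfunPex; exists (index^~ s).
  by move=> x /As /=; rewrite index_mem.
move=> x y /set_mem /As /= xs /set_mem /As /= ys eq_i.
by rewrite -(nth_index x xs) eq_i nth_index.
Qed.

Lemma card_le_seq (T : eqType) (A : set T) (m : nat) : A #<= `I_m ->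
  exists2 s : seq T, A = [set` s] & (size s <= m)%N.
Proof.
move=> Am; have /finite_seqP[s eqA] : finite_set A.
  by apply/finite_set_leP; exists m.
exists (undup s); first by rewrite eqA; apply/seteqP; split=> x /=; rewrite mem_undup.
move: Am => /pcard_leP/injfunPex[f fm f_inj].
have As x : x \in undup s -> x \in A by rewrite mem_undup => xs; rewrite inE eqA.
rewrite -(size_map f) -(size_iota 0 m); apply: uniq_leq_size.
  by rewrite map_inj_in_uniq ?undup_uniq // => x y /As xA /As yA; apply: f_inj.
by move=> _ /mapP[x /As /set_mem xA ->]; rewrite mem_iota /= add0n; apply: fm.
Qed.

Theorem lemma2 :
  forall m : nat, (0 < m)%N ->
  exists nu : nat,
  forall (k : nat) (w : group_word k), weakly_rational w ->
  forall G : groupType, residually_finite G ->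
    word_values w G #<= `I_m ->
    finite_set (verbal_subgroup w G) /\ verbal_subgroup w G #<= `I_nu.
Proof.
move=> m m_gt0; exists (m ^ (m * (2 * m)`!))%N => k w wr G rf.
move=> /card_le_seq[X eqX le_m].
suff le_nu : verbal_subgroup w G #<= `I_(m ^ (m * (2 * m)`!)).
  by split=> //; apply/finite_set_leP; eexists; apply: le_nu.
have GX h : word_values w G h -> h \in X by rewrite eqX.
have XG h : h \in X -> word_values w G h by rewrite eqX.
have X1 : 1%g \in X := GX _ (word_values1 G w).
have XJ : {in X &, forall x y, (x ^ y)%g \in X}.
  by move=> x y /XG xw _; apply/GX/word_valuesJ.
have XE : {in X, forall x, (x ^+ (2 * size X)`!)%g = 1%g}.
  by move=> x /XG; apply: expg_value_eq1.
have sub := generated_sub_word_products XJ XE (fact_gt0 _) X1.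
rewrite /verbal_subgroup eqX.
apply: card_le_trans (sub_seq_card_le sub) _; rewrite card_le_II.
rewrite size_word_products.
have le_fact : ((2 * size X)`! <= (2 * m)`!)%N by apply: leq_fact; rewrite leq_mul2l.
apply: leq_trans (leq_pexp2l m_gt0 (leq_mul le_m le_fact)).
have X_gt0 : (0 < size X)%N by case: (X) X1.
by rewrite leq_exp2r // muln_gt0 X_gt0 fact_gt0.
Qed.
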